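(* For any two persistence diagrams $Y,Y'\in\mathsf{PDgm}$, the landscape distance equals the erosion distance: $$\|\lambda^{Y}-\lambda^{Y'}\|_\infty = d_E(Y,Y').$$
   Context: Let $\mathbb{R}^2_<=\{(b,d)\in\mathbb{R}^2: b<d\}$ and $\mathbb{R}^2_\le=\{(b,d)\in\mathbb{R}^2: b\le d\}$. A persistence diagram is a finite multiset $Y=\{(b_i,d_i)\}_{i=1}^N$ of points of $\mathbb{R}^2_<$; $\mathsf{PDgm}$ is the set of all persistence diagrams. For $(b,d)\in\mathbb{R}^2_\le$, $\mathrm{rank}[Y](b,d)$ is the number (with multiplicity) of $(b_i,d_i)\in Y$ with $b_i\le b\le d<d_i$. The persistence landscape of $Y$ is $\lambda^Y=(\lambda^Y_1,\lambda^Y_2,\dots)$ with $\lambda^Y_k(t)=\sup\{h\ge 0: \mathrm{rank}[Y](t-h,t+h)\ge k\}$ for $k\in\mathbb{N}=\{1,2,\dots\}$, $t\in\mathbb{R}$ (the supremum of the empty set being $0$), and $\|\lambda^Y-\lambda^{Y'}\|_\infty=\sup_{k,t}|\lambda^Y_k(t)-\lambda^{Y'}_k(t)|$. The erosion distance $d_E(Y,Y')$ is the infimum of all $\varepsilon\ge 0$ such that, for all $b\le d$, $\mathrm{rank}[Y](b-\varepsilon,d+\varepsilon)\le \mathrm{rank}[Y'](b,d)$ and $\mathrm{rank}[Y'](b-\varepsilon,d+\varepsilon)\le \mathrm{rank}[Y](b,d)$. *)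

(* Defs.v *)
From HB Require Import structures.
From mathcomp Require Import all_boot all_order all_algebra.
From mathcomp Require Import finmap multiset.
From mathcomp Require Import all_classical all_reals ereal.

Set Implicit Arguments.
Unset Strict Implicit.
Unset Printing Implicit Defensive.

Import Order.TTheory GRing.Theory Num.Theory.
Local Open Scope classical_set_scope.
Local Open Scope ring_scope.

Definition pdgm_point (R : realType) := {p : R * R | p.1 < p.2}.

Definition pdgm (R : realType) := {mset (pdgm_point R)}%mset.

(* [count] runs over the enumeration of the multiset, in which every point is
   repeated as often as its multiplicity.  The value is 0 when [d < b]. *)
Definition rank (R : realType) (Y : pdgm R) (b d : R) : nat :=
  count (fun p : pdgm_point R =>
    [&& (val p).1 <= b, b <= d & d < (val p).2]) (enum_mset Y).

(* [sup set0 = 0], as required.  For [1 <= k] the set is bounded above (by any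
   bound of [d - t] over the points [(b, d)] of [Y]), so [sup] is the true
   supremum whenever the set is nonempty.  For [k = 0] the value is
   meaningless; that index is excluded in [landscape_dist]. *)
Definition landscape (R : realType) (Y : pdgm R) (k : nat) (t : R) : R :=
  sup [set h : R | 0 <= h /\ (k <= rank Y (t - h) (t + h))%N].

(* The two distances are taken in the extended reals, where suprema and infima
   always exist, so that no default value is involved. *)
Definition landscape_dist (R : realType) (Y Y' : pdgm R) : \bar R :=
  ereal_sup [set x : \bar R | exists k : nat, exists t : R,
    (1 <= k)%N /\ x = (`|landscape Y k t - landscape Y' k t|)%:E].

Definition erosion_dist (R : realType) (Y Y' : pdgm R) : \bar R :=
  ereal_inf [set e%:E | e in [set e : R | 0 <= e /\
    forall b d : R, b <= d ->
      (rank Y (b - e) (d + e) <= rank Y' b d)%N /\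
      (rank Y' (b - e) (d + e) <= rank Y b d)%N]].

(* Main.v *)
Require Import Defs.
From mathcomp Require Import all_boot all_order all_algebra.
From mathcomp Require Import all_classical all_reals.
From mathcomp Require Import multiset ereal lra.

Import Order.TTheory GRing.Theory Num.Theory.
Local Open Scope classical_set_scope.
Local Open Scope ring_scope.

(** The rank function of a diagram decreases when the interval is enlarged, so
    for fixed [t] and [k >= 1] the heights [h >= 0] with
    [k <= rank Y (t - h) (t + h)], if there are any, form an interval starting
    at [0] whose right end is [landscape Y k t].  Every [b <= d] is of the form
    [b = t - h], [d = t + h], so the landscapes determine the rank function up
    to the question whether the right end is itself such a height.

    Enlarging [[b, d]] by [e] on both sides fixes the centre and adds [e] to
    the half-length.  Hence an erosion inequality at [e] says that the heights
    for one diagram that are at least [e], shifted down by [e], are heights for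
    the other, which bounds the difference of the right ends by [e]
    ([landscape_le_of_erosion]).  Conversely, if the right ends differ by at
    most [r], the erosion inequality holds at each [e > r]: the strict
    inequality makes up for the undetermined end point
    ([erosion_of_landscape_le]).  Values [e] close to [r] are enough, since the
    erosion distance is an infimum. *)

Lemma rank_anti (R : realType) (Y : pdgm R) (b d b' d' : R) :
  b' <= b -> b <= d -> d <= d' -> (rank Y b' d' <= rank Y b d)%N.
Proof.
move=> b'b bd dd'; apply: sub_count => p /= /and3P[pb' _ d'p].
by rewrite (le_trans pb' b'b) bd (le_lt_trans dd' d'p).
Qed.

(** Since the diagram is finite, the sets of heights are bounded above, so that
    [landscape] is a genuine least upper bound. *)
Lemma rank_gt0_bounded (R : realType) (Y : pdgm R) :
  exists M : R, forall b d, (0 < rank Y b d)%N -> d <= M.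
Proof.
rewrite /rank; elim: (enum_mset Y) => [|p s [M HM]]; first by exists 0.
exists (Num.max (val p).2 M) => b d /=; rewrite le_max.
case: and3P => [[_ _ /ltW ->] //|_]; rewrite add0n => /HM ->.
by rewrite orbT.
Qed.

Lemma landscape_ge0 (R : realType) (Y : pdgm R) (k : nat) (t : R) :
  0 <= landscape Y k t.
Proof.
rewrite /landscape; set A := [set h | _].
have [[[h Ah] bA]|noA] := pselect (has_sup A); last by rewrite sup_out.
by apply: le_trans Ah.1 _; exact: ub_le_sup.
Qed.

Lemma landscape_ge (R : realType) (Y : pdgm R) (k : nat) (t h : R) :
  (0 < k)%N -> 0 <= h -> (k <= rank Y (t - h) (t + h))%N ->
  h <= landscape Y k t.
Proof.
move=> k0 h0 kh; apply: ub_le_sup; last by split.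
have [M HM] := rank_gt0_bounded R Y.
exists (M - t) => x [_ kx].
by rewrite lerBrDl; apply: (HM (t - x)); exact: leq_trans kx.
Qed.

Lemma landscape_le (R : realType) (Y : pdgm R) (k : nat) (t M : R) :
  0 <= M ->
  (forall h, 0 <= h -> (k <= rank Y (t - h) (t + h))%N -> h <= M) ->
  landscape Y k t <= M.
Proof.
move=> M0 HM; rewrite /landscape; set A := [set h | _].
have [->|/set0P A0] := eqVneq A set0; first by rewrite sup0.
by apply: ge_sup => // h [h0 kh]; exact: HM.
Qed.

(** Below its supremum the set of heights has no gaps, by [rank_anti]. *)
Lemma rank_ge_of_lt_landscape (R : realType) (Y : pdgm R) (k : nat) (t h : R) :
  0 <= h -> h < landscape Y k t -> (k <= rank Y (t - h) (t + h))%N.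
Proof.
move=> h0; apply: contraTT => kh; rewrite -leNgt.
apply: landscape_le => // x x0 kx; rewrite leNgt; apply: contra kh => hx.
by apply: (leq_trans kx); apply: rank_anti; lra.
Qed.

Lemma landscape_le_of_erosion (R : realType) (Y Y' : pdgm R) (e : R) :
  0 <= e ->
  (forall b d, b <= d -> (rank Y (b - e) (d + e) <= rank Y' b d)%N) ->
  forall k t, (0 < k)%N -> landscape Y k t <= landscape Y' k t + e.
Proof.
move=> e0 He k t k0; have L0 := landscape_ge0 R Y' k t.
apply: landscape_le => [|h h0 kh]; first by rewrite addr_ge0.
(* A height below [e] leaves no interval after erosion; the bound then only
   says that the other landscape is nonnegative. *)
have [he|eh] := ltP h e; first by lra.
rewrite -lerBlDr; apply: landscape_ge => //; first by rewrite subr_ge0.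
apply: leq_trans kh _.
have -> : t - h = t - (h - e) - e by lra.
have -> : t + h = t + (h - e) + e by lra.
by apply: He; lra.
Qed.

Lemma erosion_of_landscape_le (R : realType) (Y Y' : pdgm R) (r e : R) :
  0 <= e -> r < e ->
  (forall k t, (0 < k)%N -> landscape Y k t <= landscape Y' k t + r) ->
  forall b d, b <= d -> (rank Y (b - e) (d + e) <= rank Y' b d)%N.
Proof.
move=> e0 re HL b d bd.
have [->//|k0] := posnP (rank Y (b - e) (d + e)).
set k := rank Y _ _ in k0 *.
(* Centre and half-length of [[b, d]]. *)
pose t := (b + d) / 2; pose h := (d - b) / 2.
have h0 : 0 <= h by rewrite /h; lra.
have bE : b = t - h by rewrite /t /h; lra.
have dE : d = t + h by rewrite /t /h; lra.
have hk : h + e <= landscape Y k t.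
  apply: landscape_ge => //; first by rewrite addr_ge0.
  rewrite /k; have -> : t - (h + e) = b - e by lra.
  by have -> : t + (h + e) = d + e by lra.
rewrite bE dE; apply: rank_ge_of_lt_landscape => //.
by have := HL k t k0; lra.
Qed.

Theorem theorem3p19 (R : realType) (Y Y' : pdgm R) :
  landscape_dist Y Y' = erosion_dist Y Y'.
Proof.
apply/eqP; rewrite eq_le; apply/andP; split.
  apply: ge_ereal_sup => _ [k [t [k0 ->]]].
  apply: le_ereal_inf_tmp => _ [e [e0 He] <-].
  have H1 := landscape_le_of_erosion R Y Y' e e0
    (fun b d bd => (He b d bd).1) k t k0.
  have H2 := landscape_le_of_erosion R Y' Y e e0
    (fun b d bd => (He b d bd).2) k t k0.
  by rewrite lee_fin ler_norml; apply/andP; split; lra.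
have Hub k t : (0 < k)%N ->
    ((`|landscape Y k t - landscape Y' k t|)%:E <= landscape_dist Y Y')%E.
  by move=> k0; apply: ereal_sup_ubound; exists k, t.
have D0 : (0 <= landscape_dist Y Y')%E.
  by apply: le_trans (Hub 1%N 0 isT); rewrite lee_fin.
case: (landscape_dist Y Y') D0 Hub => [r|_ _|//]; last by rewrite leey.
rewrite lee_fin => r0 Hub.
apply/lee_addgt0Pr => eps eps0; apply: ereal_inf_lbound.
have re : r < r + eps by rewrite ltrDl.
have e0 : 0 <= r + eps by lra.
exists (r + eps) => //; split=> // b d bd.
by split; apply: (erosion_of_landscape_le R _ _ r) => // k t k0;
  have := Hub k t k0; rewrite lee_fin ler_norml => /andP[]; lra.
Qed.
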